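(* (i) Let $X$ be a metrizable topological space and $\mathcal F$ a topologically contracting function system on $X$. Then there is a metric $d$ on $X$ generating the topology of $X$ such that $\mathcal F$ is Edelstein contracting with respect to $d$. (ii) Let $X$ be a completely metrizable topological space and $\mathcal F$ a topologically contracting function system on $X$. Then there is a complete metric $d$ on $X$ generating the topology of $X$ such that $\mathcal F$ is Edelstein contracting with respect to $d$.
   Context: All spaces are non-empty. $\omega=\{0,1,2,\dots\}$. A space is completely metrizable if its topology is generated by a complete metric. A function system on a topological space $X$ is a non-empty finite family $\mathcal F$ of continuous maps $X\to X$; $\mathcal F(A)=\bigcup_{f\in\mathcal F}f(A)$ for $A\subset X$. $\mathcal F$ is compact-dominating if each compact $C\subset X$ is contained in a compact $K\subset X$ with $\mathcal F(K)\subset K$. $\mathcal F$ is topologically contracting if it is compact-dominating and for every non-empty compact $K\subset X$ with $\mathcal F(K)\subset K$ and every sequence $(f_n)_{n\in\omega}\in\mathcal F^\omega$ the intersection $\bigcap_{n\in\omega}f_0\circ\dots\circ f_n(K)$ is a singleton. $\mathcal F$ is Edelstein contracting with respect to a metric $d$ if $d(f(x),f(y))<d(x,y)$ for every $f\in\mathcal F$ and any distinct points $x,y\in X$. *)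

(* Defs.v *)
From HB Require Import structures.
From mathcomp Require Import all_boot all_order all_algebra.
From mathcomp Require Import all_classical all_reals all_analysis.

Set Implicit Arguments.
Unset Strict Implicit.
Unset Printing Implicit Defensive.

Import Order.TTheory GRing.Theory Num.Theory.

Local Open Scope classical_set_scope.
Local Open Scope ring_scope.

(* [metricType] bundles one metric with the topology that it
   induces. Here the topology is given and metrics are quantified over, so a
   metric is an unbundled function [d : X -> X -> R]. *)

Definition is_metric (R : realType) (X : Type) (d : X -> X -> R) : Prop :=
  [/\ forall x y, 0 <= d x y,
      forall x y, d x y = 0 <-> x = y,
      forall x y, d x y = d y x
    & forall x y z, d x z <= d x y + d y z].

Definition generates_topology (R : realType) (X : topologicalType)
    (d : X -> X -> R) : Prop :=
  forall U : set X, open U <->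
    (forall x, U x -> exists2 e : R, 0 < e & [set y | d x y < e] `<=` U).

Definition complete_metric (R : realType) (X : Type) (d : X -> X -> R) : Prop :=
  forall u : nat -> X,
    (forall e : R, 0 < e -> exists N : nat, forall m n : nat,
      (N <= m)%N -> (N <= n)%N -> d (u m) (u n) < e) ->
    exists x : X, forall e : R, 0 < e -> exists N : nat, forall n : nat,
      (N <= n)%N -> d (u n) x < e.

Definition metrizable (R : realType) (X : topologicalType) : Prop :=
  exists d : X -> X -> R, is_metric d /\ generates_topology d.

Definition completely_metrizable (R : realType) (X : topologicalType) : Prop :=
  exists d : X -> X -> R,
    [/\ is_metric d, generates_topology d & complete_metric d].

Definition function_system (X : topologicalType) (F : set (X -> X)) : Prop :=
  [/\ F !=set0, finite_set F & forall f, F f -> continuous f].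

Definition system_image (X : Type) (F : set (X -> X)) (A : set X) : set X :=
  \bigcup_(f in F) (f @` A).

Definition compact_dominating (X : topologicalType) (F : set (X -> X)) : Prop :=
  forall C : set X, compact C ->
    exists K : set X, [/\ compact K, C `<=` K & system_image F K `<=` K].

(* [iter_comp f n] is [f 0 \o f 1 \o ... \o f n], with n + 1 factors. *)
Fixpoint iter_comp (X : Type) (f : nat -> X -> X) (n : nat) : X -> X :=
  if n is m.+1 then iter_comp f m \o f m.+1 else f 0%N.

Definition topologically_contracting (X : topologicalType)
    (F : set (X -> X)) : Prop :=
  compact_dominating F /\
  forall K : set X, K !=set0 -> compact K -> system_image F K `<=` K ->
    forall f : nat -> X -> X, (forall n, F (f n)) ->
      exists x : X, \bigcap_n (iter_comp f n @` K) = [set x].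

Definition edelstein_contracting (R : realType) (X : Type) (d : X -> X -> R)
    (F : set (X -> X)) : Prop :=
  forall f, F f -> forall x y : X, x <> y -> d (f x) (f y) < d x y.

(* Main.v *)
Require Import Defs.
From mathcomp Require Import all_boot all_order all_algebra.
From mathcomp Require Import all_classical all_reals all_analysis.
From mathcomp Require Import lra.

(** Let [rho] be a metric of the space, and write |g| for the length of a word
    [g], a composition of maps from [F].  Both parts are witnessed by

      d(x, y) = sup over words [g] of (2 - 2^-|g|) * rho (g x, g y).

    Composing with a map of [F] lengthens every word by one letter, and the
    weights strictly increase with the length, so passing from [(x, y)] to
    [(f x, f y)] strictly lowers each weight in the supremum.  The inequality
    survives the supremum because only finitely many lengths matter: the terms
    of long words are small.

    Smallness of long words is where topological contraction enters.  On a
    compact [F]-invariant set [K], the sets [g K] have diameter tending to [0]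
    uniformly in |g| ([words_shrink]): otherwise Koenig's lemma, applied to the
    finitely branching tree of words whose extensions misbehave, yields one
    infinite sequence of maps along which the diameters do not tend to [0],
    whereas the nested compact sets along it shrink to a point
    ([iter_comp_shrinks]).  Compact domination extends this to any two points
    (which makes [d] finite), and to any convergent sequence with its limit,
    which is compact; along such a sequence the long words are uniformly small
    and the finitely many short ones are continuous, so [d] is continuous for
    [rho] ([orbit_metric_continuous]).

    As [rho <= d] (take the empty word), [d] generates the same topology, and a
    [d]-Cauchy sequence is [rho]-Cauchy, so completeness of [rho] passes to
    [d].  This single [d] thus serves both parts. *)

Local Open Scope classical_set_scope.

Section EdelsteinMetrization.
Import Order.TTheory GRing.Theory Num.Theory.
Local Open Scope ring_scope.

(** * Preliminaries *)

Lemma finite_uniform_bound (T : choiceType) (A : set T) (P : T -> nat -> Prop) :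
  finite_set A ->
  (forall a m n, (m <= n)%N -> P a m -> P a n) ->
  (forall a, A a -> exists n, P a n) ->
  exists n, forall a, A a -> P a n.
Proof.
move=> /finite_seqP[s ->] Pmono; elim: s => [|a s IHs] hP.
  by exists 0%N.
have [b bs|n hn] := IHs; first by apply: hP; rewrite /= inE bs orbT.
have [|m hm] := hP a; first by rewrite /= inE eqxx.
exists (maxn m n) => b; rewrite /= inE => /orP[/eqP->|bs].
  by apply: Pmono hm; exact: leq_maxl.
by apply: Pmono (hn _ bs); exact: leq_maxr.
Qed.

Lemma ltr_invS {R : realType} (e : R) : 0 < e -> exists k : nat, k.+1%:R^-1 < e.
Proof. by move=> /ltr_add_invr[k]; rewrite add0r; exists k. Qed.

Lemma lef_invS {R : realType} (m n : nat) : (m <= n)%N -> n.+1%:R^-1 <= m.+1%:R^-1 :> R.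
Proof. by move=> mn; rewrite lef_pV2 ?posrE ?ltr0n// ler_nat ltnS. Qed.

(** * Metrics generating a given topology *)

Section Metrics.
Context {R : realType} {X : topologicalType} (rho : X -> X -> R).
Hypotheses (rho_metric : is_metric rho) (rho_top : generates_topology rho).

Let rho_ge0 x y : 0 <= rho x y. Proof. by case: rho_metric. Qed.
Let rho_eq0 x y : rho x y = 0 <-> x = y. Proof. by case: rho_metric. Qed.
Let rho_sym x y : rho x y = rho y x. Proof. by case: rho_metric. Qed.
Let rho_tri x y z : rho x z <= rho x y + rho y z.
Proof. by case: rho_metric. Qed.
Let rho_refl x : rho x x = 0. Proof. exact/rho_eq0. Qed.
Let rho_gt0 x y : x <> y -> 0 < rho x y.
Proof. by move=> xy; rewrite lt_neqAle rho_ge0 andbT eq_sym; apply/eqP => /rho_eq0. Qed.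

Lemma nbhs_metric_ball x (e : R) : 0 < e -> nbhs x [set y | rho x y < e].
Proof.
move=> e0; apply: open_nbhs_nbhs; split; last by rewrite /= rho_refl.
apply/rho_top => y /= xy; exists (e - rho x y); first by rewrite subr_gt0.
by move=> z /= yz; have := rho_tri x y z; lra.
Qed.

Lemma nbhs_metricP x (U : set X) :
  nbhs x U -> exists2 e : R, 0 < e & [set y | rho x y < e] `<=` U.
Proof.
rewrite nbhsE => -[V [oV Vx] VU].
by have [e e0 eV] := (rho_top V).1 oV x Vx; exists e => // y /eV/VU.
Qed.

Lemma metric_hausdorff : hausdorff_space X.
Proof.
move=> x y xy; apply: contrapT => /rho_gt0 r0.
have h0 : 0 < rho x y / 2 by lra.
have [z [/= xz yz]] := xy _ _ (nbhs_metric_ball x _ h0) (nbhs_metric_ball y _ h0).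
by have := rho_tri x z y; rewrite (rho_sym z); lra.
Qed.

(** A filter that does not cluster at [x] lives on the part of the sequence
    outside some neighbourhood of [x], which is finite, hence compact. *)
Lemma compact_seq_limit (x : X) (u : nat -> X) :
  (forall k, rho x (u k) < k.+1%:R^-1) -> compact (x |` range u).
Proof.
move=> ux G PG GA.
have [clx|] := pselect (cluster G x); first by exists x; split => //; left.
move=> /existsNP[B /existsNP[V /not_implyP[GB /not_implyP[xV BV]]]].
have [e e0 eV] := nbhs_metricP _ _ xV.
have [N Ne] := ltr_invS _ e0.
have finI : finite_set (u @` `I_N) by apply: finite_image; exact: finite_II.
have [|p [[k kN <-] clp]] := finite_compact finI PG.
  apply: (filterS _ (filterI GA GB)) => z [Az Bz].
  have nVz : ~ V z by move=> Vz; apply: BV; exists z.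
  case: Az => [zx|[k _ kz]].
    by exfalso; apply: nVz; rewrite zx; exact: nbhs_singleton xV.
  exists k => //=; rewrite ltnNge; apply/negP => Nk; apply: nVz; apply: eV.
  by rewrite /= -kz; apply: lt_trans Ne; apply: lt_le_trans (ux k) (lef_invS _ _ Nk).
by exists (u k); split => //; right; exists k.
Qed.

(** * Words in a function system shrink invariant compact sets *)

Section System.
Variable F : set (X -> X).

Fixpoint words n : set (X -> X) :=
  if n is m.+1 then [set g \o f | g in words m & f in F] else [set id].

(** [words] grows at the inner end, the end at which the strict contraction of
    the new metric adds a letter; extending a branch of the tree of words needs
    the outer letter split off instead. *)
Lemma words_consl n h :
  words n.+1 h -> exists f g, [/\ F f, words n g & h = f \o g].
Proof.
elim: n h => [|n IHn] _ [g wg [f Ff <-]].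
  by rewrite /= in wg; subst g; exists f, id.
have [f' [g' [Ff' wg' ->]]] := IHn g wg.
by exists f', (g' \o f); split => //; exists g' => //; exists f.
Qed.

Lemma words_stable n g K : system_image F K `<=` K ->
  words n g -> forall x, K x -> K (g x).
Proof.
move=> FK; elim: n g => [_ ->//|n IHn _ [g wg [f Ff <-]] x Kx].
by apply: IHn wg _ _; apply: FK; exists f => //; exists x.
Qed.

Lemma words_continuous n g : (forall f, F f -> continuous f) ->
  words n g -> continuous g.
Proof.
move=> Fc; elim: n g => [_ ->|n IHn _ [g wg [f Ff <-]]] x; first exact.
by apply: continuous_comp; [exact: Fc|exact: IHn wg _].
Qed.

Lemma iter_comp_words (f : nat -> X -> X) n : (forall k, F (f k)) ->
  words n.+1 (iter_comp f n).
Proof.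
move=> Ff; elim: n => [|n IHn]; first by exists id => //; exists (f 0%N).
by exists (iter_comp f n) => //; exists (f n.+1).
Qed.

Lemma finite_short_words N : finite_set F ->
  finite_set (\bigcup_(n in `I_N) words n).
Proof.
move=> finF; apply: bigcup_finite => [|n _]; first exact: finite_II.
elim: n => [|n IHn]; first exact: finite_set1.
exact: finite_image2.
Qed.

Hypotheses (F_sys : function_system F) (F_tc : topologically_contracting F).

Let finF : finite_set F. Proof. by case: F_sys. Qed.
Let contF f : F f -> continuous f. Proof. by case: F_sys => _ _; exact. Qed.

(** The nested compact sets [f 0 \o ... \o f n @` K] have a single common point
    [p], so they eventually enter every ball around [p]: points staying outside
    would cluster at a common point of these sets other than [p]. *)
Lemma iter_comp_shrinks (K : set X) (f : nat -> X -> X) (e : R) :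
  compact K -> system_image F K `<=` K -> (forall n, F (f n)) -> 0 < e ->
  exists n, forall x y, K x -> K y ->
    rho (iter_comp f n x) (iter_comp f n y) < e.
Proof.
move=> cK FK Ff e0; have [K0|] := pselect (K !=set0); last first.
  by move=> K0; exists 0%N => x y Kx; exfalso; apply: K0; exists x.
have [p pE] := F_tc.2 K K0 cK FK f Ff.
have h0 : 0 < e / 2 by lra.
suff [n hn] : exists n, forall x, K x -> rho p (iter_comp f n x) < e / 2.
  exists n => x y Kx Ky; have := rho_tri (iter_comp f n x) p (iter_comp f n y).
  by rewrite (rho_sym _ p); have := hn x Kx; have := hn y Ky; lra.
apply: contrapT => /forallNP far.
have {far} /choice[u uP] n : exists x, K x /\ e / 2 <= rho p (iter_comp f n x).
  have /existsNP[x /not_implyP[Kx /negP]] := far n.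
  by rewrite -leNgt; exists x.
pose L n := iter_comp f n @` K.
have KL n x : L n x -> K x.
  by move=> [z Kz <-]; apply: words_stable (iter_comp_words f n Ff) _ Kz.
have Ldecr m n : (m <= n)%N -> L n `<=` L m.
  move=> mn; rewrite -(subnKC mn); elim: (n - m)%N => [|k IHk]; first by rewrite addn0.
  rewrite addnS => _ [z Kz <-]; apply: IHk => /=; exists (f (m + k).+1 z) => //.
  by apply: FK; exists (f (m + k).+1) => //; exists z.
have Lclosed n : closed (L n).
  apply: compact_closed; first exact: metric_hausdorff.
  apply: continuous_compact cK; apply: continuous_subspaceT.
  exact: words_continuous contF (iter_comp_words f n Ff).
pose y n := iter_comp f n (u n).
have Ly n : L n (y n) by exists (u n) => //; case: (uP n).
have yoo : ProperFilter (y @ \oo) by exact: fmap_proper_filter.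
have [|q [Kq clq]] := cK _ yoo.
  by exists 0%N => // n _; exact: KL (Ly n).
have Lq n : L n q.
  apply: Lclosed => B qB.
  have [|z [Lz Bz]] := clq (L n) B _ qB; last by exists z.
  by exists n => // k /= nk; exact: Ldecr nk _ (Ly k).
have qp : q = p by have : [set p] q by rewrite -pE => n _; exact: Lq.
have [|z [/= pz qz]] :=
    clq [set z | e / 2 <= rho p z] _ _ (nbhs_metric_ball q _ h0).
  by exists 0%N => // n _; case: (uP n).
by move: qz; rewrite qp ltNge pz.
Qed.

(** Koenig's lemma.  If all [h \o f] with [f] in the finite set [F] admit a
    threshold length, so does [h]; hence a failure at [id] propagates along an
    infinite branch, which contradicts [iter_comp_shrinks]. *)
Lemma words_shrink (K : set X) (e : R) :
  compact K -> system_image F K `<=` K -> 0 < e ->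
  exists N, forall n g, (N <= n)%N -> words n g ->
    forall x y, K x -> K y -> rho (g x) (g y) < e.
Proof.
move=> cK FK e0.
pose short h := forall x y, K x -> K y -> rho (h x) (h y) < e.
pose ok h N := forall n g, (N <= n)%N -> words n g -> short (h \o g).
have okS h : (forall f, F f -> exists N, ok (h \o f) N) -> exists N, ok h N.
  move=> okF.
  have [|N hN] := finite_uniform_bound _ _ (fun f => ok (h \o f)) finF _ okF.
    by move=> f m n mn hm k g nk; apply: hm; exact: leq_trans nk.
  exists N.+1 => -[//|n] g Nn /words_consl[f [g' [Ff wg' ->]]].
  exact: hN Ff n g' Nn wg'.
apply: contrapT => bad0.
have step (h : {h | ~ exists N, ok h N}) :
    exists f : X -> X, F f /\ ~ exists N, ok (sval h \o f) N.
  case: h => h /= bad; apply: contrapT => good; apply: bad; apply: okS => f Ff.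
  by apply: contrapT => bad; apply: good; exists f.
have [next nextP] := choice step.
pose extend h : {h | ~ exists N, ok h N} :=
  exist _ (sval h \o next h) (nextP h).2.
pose branch n := iter n extend (exist _ id bad0).
pose f n := next (branch n).
have Ff n : F (f n) by case: (nextP (branch n)).
have branchE n : iter_comp f n = sval (branch n.+1).
  by elim: n => [//|n IHn] /=; rewrite IHn.
have [n hn] := iter_comp_shrinks K f e cK FK Ff e0.
have := svalP (branch n.+1); apply; rewrite -branchE.
exists 0%N => k g _ wg x y Kx Ky.
by apply: hn; exact: words_stable wg _ _.
Qed.

(** * The supremum metric *)

(** Any strictly increasing bounded weights bounded away from [0] would do;
    these have the increments [2^-(n+1)], which decrease with [n]. *)
Definition gauge n : R := 2 - 2^-1 ^+ n.

Definition orbit_metric x y : R :=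
  sup [set r | exists n, exists2 g, words n g & r = gauge n * rho (g x) (g y)].

Lemma gaugeS n : gauge n.+1 = gauge n + 2^-1 ^+ n.+1.
Proof. by rewrite /gauge exprS; lra. Qed.

Lemma gauge_ge1 n : 1 <= gauge n.
Proof.
have : (2^-1 : R) ^+ n <= 1 by apply: exprn_ile1; lra.
by rewrite /gauge; lra.
Qed.

Lemma gauge_le2 n : gauge n <= 2.
Proof.
have : 0 <= (2^-1 : R) ^+ n by apply: exprn_ge0; lra.
by rewrite /gauge; lra.
Qed.

Let gauge_ge0 n : 0 <= gauge n.
Proof. exact: le_trans ler01 (gauge_ge1 n). Qed.

Lemma gaugeM_lt n (r e : R) : 0 <= r -> r < e / 2 -> gauge n * r < e.
Proof.
move=> r0 re; apply: le_lt_trans (ler_wpM2r r0 (gauge_le2 n)) _; lra.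
Qed.

Lemma words_shrink2 x y (e : R) : 0 < e -> exists N, forall n g,
  (N <= n)%N -> words n g -> rho (g x) (g y) < e.
Proof.
move=> e0.
have [|K [cK CK FK]] := F_tc.1 [set x; y].
  by apply: finite_compact; rewrite finite_setU.
have [N hN] := words_shrink K e cK FK e0.
by exists N => n g Nn wg; apply: hN wg _ _ _ _ => //; apply: CK; [left|right].
Qed.

Lemma orbit_metric_le x y (M : R) :
  (forall n g, words n g -> gauge n * rho (g x) (g y) <= M) ->
  orbit_metric x y <= M.
Proof.
move=> hM; apply: ge_sup; first by exists (gauge 0 * rho x y), 0%N, id.
by move=> _ [n [g wg ->]]; exact: hM.
Qed.

(** The content is that the supremum is finite: long words bring [x] and [y]
    within distance [1], and there are finitely many short words. *)
Lemma le_orbit_metric x y n g : words n g ->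
  gauge n * rho (g x) (g y) <= orbit_metric x y.
Proof.
move=> wg; apply: sup_upper_bound; last by exists n, g.
split; first by exists (gauge 0 * rho x y), 0%N, id.
have [N hN] := words_shrink2 x y 1 ltr01.
have [||M hM] := finite_uniform_bound _ _
    (fun h m => rho (h x) (h y) <= m%:R) (finite_short_words N finF).
- by move=> h m k mk /le_trans; apply; rewrite ler_nat.
- by move=> h _; exists (Num.bound (rho (h x) (h y))); exact/ltW/archi_boundP.
exists (2 * (M%:R + 1)) => _ [k [h wh ->]].
apply: ler_pM => //; first exact: gauge_le2.
have M0 : 0 <= M%:R :> R by [].
case: (leqP N k) => [Nk|kN]; first by have := hN k h Nk wh; lra.
by apply: le_trans (hM h _) _; [exists k|lra].
Qed.

Lemma metric_le_orbit_metric x y : rho x y <= orbit_metric x y.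
Proof.
have /= := le_orbit_metric x y 0 id erefl.
by have := ler_wpM2r (rho_ge0 x y) (gauge_ge1 0); lra.
Qed.

Lemma orbit_metric_is_metric : is_metric orbit_metric.
Proof.
have orbit_ge0 x y : 0 <= orbit_metric x y.
  exact: le_trans (rho_ge0 x y) (metric_le_orbit_metric x y).
have orbit_sym_le x y : orbit_metric x y <= orbit_metric y x.
  by apply: orbit_metric_le => n g wg; rewrite rho_sym; exact: le_orbit_metric.
split=> [//|x y|x y|x y z].
- split=> [xy|->]; last first.
    apply/eqP; rewrite eq_le orbit_ge0 andbT.
    by apply: orbit_metric_le => n g _; rewrite rho_refl mulr0.
  apply/rho_eq0/eqP; rewrite eq_le rho_ge0 andbT -xy.
  exact: metric_le_orbit_metric.
- by apply/eqP; rewrite eq_le !orbit_sym_le.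
- apply: orbit_metric_le => n g wg.
  apply: le_trans (ler_wpM2l (gauge_ge0 n) (rho_tri _ (g y) _)) _.
  by rewrite mulrDr; apply: lerD; exact: le_orbit_metric.
Qed.

(** The argument goes through sequences because a neighbourhood of [x] need not
    lie in a compact set, so compact domination says nothing about it directly;
    it does apply to a sequence converging to [x] together with its limit. *)
Lemma orbit_metric_continuous x (e : R) : 0 < e ->
  exists2 dl : R, 0 < dl & [set y | rho x y < dl] `<=` [set y | orbit_metric x y < e].
Proof.
move=> e0; apply: contrapT => nocont.
have /choice[u uP] (k : nat) : exists y, rho x y < k.+1%:R^-1 /\ e <= orbit_metric x y.
  apply: contrapT => /forallNP noy; apply: nocont.
  exists k.+1%:R^-1; first by rewrite invr_gt0.
  move=> y /= xy; rewrite ltNge; apply/negP => ey.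
  by apply: (noy y).
have ux k : rho x (u k) < k.+1%:R^-1 by case: (uP k).
have [K [cK CK FK]] := F_tc.1 _ (compact_seq_limit x u ux).
have e4 : 0 < e / 2 / 2 by lra.
have [N hN] := words_shrink K _ cK FK e4.
have [||k hk] := finite_uniform_bound _ _
    (fun h k => forall y, rho x y < k.+1%:R^-1 -> rho (h x) (h y) < e / 2 / 2)
    (finite_short_words N finF).
- by move=> h m n mn hm y /lt_le_trans xy; apply: hm; apply: xy; exact: lef_invS.
- move=> h [n _ wh].
  have [dl dl0 hdl] := nbhs_metricP x _
    (words_continuous n h contF wh x _ (nbhs_metric_ball (h x) _ e4)).
  have [k kdl] := ltr_invS _ dl0.
  by exists k => y /lt_trans /(_ kdl); exact: hdl.
have : orbit_metric x (u k) <= e / 2.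
  apply: orbit_metric_le => n g wg; apply/ltW/gaugeM_lt => //.
  case: (leqP N n) => [Nn|nN].
    by apply: hN wg _ _ _ _ => //; apply: CK; [left|right; exists k].
  by apply: hk (ux k); exists n.
by have := (uP k).2; lra.
Qed.

(** Balls of the two metrics refine each other, by [metric_le_orbit_metric] one
    way and [orbit_metric_continuous] the other. *)
Lemma orbit_metric_generates : generates_topology orbit_metric.
Proof.
move=> U; rewrite rho_top; split=> hU x /hU[e e0 eU].
  exists e => // y /= xy; apply: eU.
  exact: le_lt_trans (metric_le_orbit_metric x y) xy.
have [dl dl0 hdl] := orbit_metric_continuous x e e0.
by exists dl => //; exact: subset_trans eU.
Qed.

(** Each term for [(f x, f y)] falls short of a term for [(x, y)] by the
    increment of the weight times [rho (g (f x)) (g (f y))].  This shortfall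
    need not have a positive lower bound over all words, so terms with a small
    distance are bounded separately, by half of [rho (f x) (f y)]. *)
Lemma orbit_metric_edelstein : edelstein_contracting orbit_metric F.
Proof.
move=> f Ff x y xy.
have [fxy|/rho_gt0 s0] := pselect (f x = f y).
  have [_ + _ _] := orbit_metric_is_metric => /(_ (f x) (f y))/iffRL/(_ fxy) ->.
  exact: lt_le_trans (rho_gt0 _ _ xy) (metric_le_orbit_metric x y).
set s := rho (f x) (f y) in s0.
have step n g : words n g ->
    gauge n.+1 * rho (g (f x)) (g (f y)) <= orbit_metric x y.
  by move=> wg; apply: (le_orbit_metric x y n.+1 (g \o f)); exists g => //; exists f.
have sD : s <= orbit_metric x y.
  have := step 0%N id erefl; rewrite -/s.
  by have := ler_wpM2r (ltW s0) (gauge_ge1 1); lra.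
have s4 : 0 < s / 2 / 2 by lra.
have [N hN] := words_shrink2 (f x) (f y) _ s4.
(* A lower bound of the increments over lengths below [N], times the least distance
   [s / 4] in the case of a large distance. *)
pose gap : R := 2^-1 ^+ N.+1 * (s / 2 / 2).
have gap0 : 0 < gap by rewrite mulr_gt0// exprn_gt0//; lra.
have gap_le : gap <= s / 2.
  have : (2^-1 : R) ^+ N.+1 <= 1 by apply: exprn_ile1; lra.
  by move=> /(ler_wpM2r (ltW s4)); rewrite -/gap; lra.
suff : orbit_metric (f x) (f y) <= orbit_metric x y - gap by lra.
apply: orbit_metric_le => n g wg.
have := step n g wg; rewrite gaugeS mulrDl.
(* Distances below a quarter of [s] give terms of at most [s / 2], and [s] is
   at most [orbit_metric x y]; larger distances occur only for [n < N]. *)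
have [small|big] := ltP (rho (g (f x)) (g (f y))) (s / 2 / 2).
  by have := gaugeM_lt n _ _ (rho_ge0 _ _) small; lra.
have nN : (n < N)%N.
  by rewrite ltnNge; apply/negP => Nn; have := hN n g Nn wg; rewrite ltNge big.
suff : gap <= 2^-1 ^+ n.+1 * rho (g (f x)) (g (f y)) by lra.
apply: ler_pM => //; first exact: ltW.
by apply: ler_wiXn2l; [lra|lra|rewrite ltnS ltnW].
Qed.

Lemma orbit_metric_complete : complete_metric rho -> complete_metric orbit_metric.
Proof.
move=> rho_complete u u_cauchy.
have [e e0|x ux] := rho_complete u.
  have [N hN] := u_cauchy e e0; exists N => m n Nm Nn.
  exact: le_lt_trans (metric_le_orbit_metric _ _) (hN m n Nm Nn).
exists x => e e0; have [dl dl0 hdl] := orbit_metric_continuous x e e0.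
have [N hN] := ux dl dl0; exists N => n Nn.
have [_ _ -> _] := orbit_metric_is_metric.
by apply: hdl => /=; rewrite rho_sym; exact: hN.
Qed.

End System.
End Metrics.
End EdelsteinMetrization.

Theorem corollary6p4 (R : realType) :
  (forall (X : topologicalType) (F : set (X -> X)),
     [set: X] !=set0 -> metrizable R X ->
     function_system F -> topologically_contracting F ->
     exists d : X -> X -> R,
       [/\ is_metric d, generates_topology d & edelstein_contracting d F])
  /\
  (forall (X : topologicalType) (F : set (X -> X)),
     [set: X] !=set0 -> completely_metrizable R X ->
     function_system F -> topologically_contracting F ->
     exists d : X -> X -> R,
       [/\ is_metric d, complete_metric d, generates_topology d
         & edelstein_contracting d F]).
Proof.
split=> X F _ [rho].
  move=> [rhoM rhoT] Fsys Ftc; exists (orbit_metric rho F); split.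
  - exact: orbit_metric_is_metric.
  - exact: orbit_metric_generates.
  - exact: orbit_metric_edelstein.
move=> [rhoM rhoT rhoC] Fsys Ftc; exists (orbit_metric rho F); split.
- exact: orbit_metric_is_metric.
- exact: orbit_metric_complete.
- exact: orbit_metric_generates.
- exact: orbit_metric_edelstein.
Qed.
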